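(* Let $V\subset X$ be a $p$-dimensional subspace, $0\le q\le n=\dim X$, and let $W_{\mathbf{i}}$, $\mathbf{i}\in\mathcal{I}_q^n$, be the coordinate $q$-subspaces of an orthogonal basis of $X$. (i) If $p\le q$ then $\sum_{\mathbf{i}\in\mathcal{I}_q^n}\cos^2\Theta_{V,W_{\mathbf{i}}}=\binom{n-p}{n-q}$. (ii) If $p>q$ then $\sum_{\mathbf{i}\in\mathcal{I}_q^n}\cos^2\Theta_{W_{\mathbf{i}},V}=\binom{p}{q}$.
   Context: $X$ is an $n$-dimensional vector space over $\mathbb{R}$ (real case) or $\mathbb{C}$ (complex case) with an inner product $\langle\cdot,\cdot\rangle$ (Hermitian in the complex case, conjugate-linear in the left entry). Subspaces and dimensions are over the same field. For integers $1\le q\le n$, $\mathcal{I}_q^n=\{(i_1,\dots,i_q)\in\mathbb{N}^q:1\le i_1<\dots<i_q\le n\}$, and $\mathcal{I}_0^n=\{0\}$. For a basis $(w_1,\dots,w_n)$ of $X$, its coordinate $q$-subspaces are the $\binom{n}{q}$ subspaces $W_{\mathbf{i}}=\operatorname{span}(w_{i_1},\dots,w_{i_q})$, $\mathbf{i}=(i_1,\dots,i_q)\in\mathcal{I}_q^n$; the coordinate $0$-subspace is $W_0=\{0\}$. Principal angles: for nonzero subspaces $V,W\subset X$, with $p=\dim V$, $q=\dim W$, $m=\min\{p,q\}$, there are orthonormal bases $(e_1,\dots,e_p)$ of $V$ and $(f_1,\dots,f_q)$ of $W$ and uniquely determined numbers $0\le\theta_1\le\dots\le\theta_m\le\frac{\pi}{2}$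 (the principal angles) such that $\langle e_i,f_j\rangle=\delta_{ij}\cos\theta_i$ (equal to $0$ whenever $i\neq j$). Grassmann angle: for nonzero subspaces $V,W\subset X$ with principal angles $\theta_1,\dots,\theta_m$, the Grassmann angle $\Theta_{V,W}\in[0,\frac{\pi}{2}]$ of $V$ with $W$ is $\Theta_{V,W}=\arccos(\cos\theta_1\cdots\cos\theta_m)$ if $\dim V\le\dim W$, and $\Theta_{V,W}=\frac{\pi}{2}$ if $\dim V>\dim W$. Also $\Theta_{\{0\},\{0\}}=\Theta_{\{0\},V}=0$ and $\Theta_{V,\{0\}}=\frac{\pi}{2}$ for $V\ne\{0\}$. *)

(* Defs.v *)
From HB Require Import structures.
From mathcomp Require Import all_boot all_order all_algebra.
From mathcomp Require Import all_classical all_reals all_analysis.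
From mathcomp Require Export complex.
Set Implicit Arguments.
Unset Strict Implicit.
Unset Printing Implicit Defensive.
Import Order.TTheory GRing.Theory Num.Theory.
Local Open Scope classical_set_scope.
Local Open Scope ring_scope.

Section Grassmann.
(* The scalar field [F] is meant to be [R] or [R[i]], with conjugation [theta]
   and [iota] the inclusion of the reals.  The forms [{dot X for theta}] are
   linear in the left and conjugate-linear in the right argument, so the inner
   product <u, v>, conjugate-linear in the left entry, is [dot v u]. *)
Variables (R : realType) (F : numFieldType).
Variables (iota : {rmorphism R -> F}) (theta : {rmorphism F -> F}).
Variables (X : vectType F) (dot : {dot X for theta}).

Definition orthonormal_basis (V : {vspace X}) (e : seq X) : Prop :=
  basis_of V e /\ orthonormal dot e.

Definition orthogonal_basis (V : {vspace X}) (w : seq X) : Prop :=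
  basis_of V w /\ pairwise_orthogonal dot w.

Definition is_principal_angles (V W : {vspace X}) (t : seq R) : Prop :=
  [/\ size t = minn (\dim V) (\dim W),
      sorted <=%R t,
      {in t, forall a, 0 <= a <= pi / 2} &
      exists e f : seq X,
        [/\ orthonormal_basis V e, orthonormal_basis W f &
            forall i j : nat, (i < \dim V)%N -> (j < \dim W)%N ->
              dot f`_j e`_i = if i == j then iota (cos t`_i) else 0]].

(* The principal angles exist and are unique, so the default is not used. *)
Definition principal_angles (V W : {vspace X}) : seq R :=
  xget [::] [set t | is_principal_angles V W t].

Definition grassmann_angle (V W : {vspace X}) : R :=
  if V == 0%VS then 0
  else if W == 0%VS then pi / 2
  else if (\dim V <= \dim W)%N
       then acos (\prod_(t <- principal_angles V W) cos t)
       else pi / 2.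

(* Indices range over {0, ..., n-1}; for q = 0 the only index is the empty
   tuple, whose coordinate subspace is {0}. *)
Definition increasing_tuples (n q : nat) : {set q.-tuple 'I_n} :=
  [set i : q.-tuple 'I_n | sorted ltn (map val i)]%SET.

Definition coordinate_subspace (n q : nat) (w : n.-tuple X)
    (i : q.-tuple 'I_n) : {vspace X} :=
  <<[seq tnth w k | k <- i]>>%VS.

End Grassmann.

(* Main.v *)
Require Import Defs.
From HB Require Import structures.
From mathcomp Require Import all_boot all_order all_algebra.
From mathcomp Require Import perm.
From mathcomp Require Import all_classical all_reals all_analysis.
Set Implicit Arguments.
Unset Strict Implicit.
Unset Printing Implicit Defensive.
Import Order.TTheory GRing.Theory Num.Theory.
Local Open Scope ring_scope.

(** For orthonormal bases a of V and f of W, with dim V <= dim W, write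
    [gram a f] for the matrix of inner products.  In principal bases this matrix
    is diagonal with entries cos theta_i, and a change of orthonormal bases
    multiplies it by unitary matrices on both sides, so
      cos^2 Theta_(V,W) = det (gram a f * gram f a)
    whatever the bases ([cos2_grassmann_angle]).

    Let u be the normalised coordinate basis of X, A := gram a u (a p x n matrix)
    and B := gram u a, its adjoint; Parseval's identity gives A * B = 1.  The
    subspace W_i has the orthonormal basis (u_k) for k in i, so the sums
    in the theorem become sums of minors:
      p <= q:  sum over i of det (A_i * B^i),
      p > q:   sum over i of det (B^i * A_i),
    where A_i keeps the columns and B^i the rows with index in i.

    Expanding the first determinant multilinearly over all maps f from the p rows
    to the n columns, only injective f contribute, and the term of f occurs in
    det (A_i * B^i) exactly when i contains the image of f.  An image of p indices
    lies in C(n-p, n-q) index sets of size q, so the first sum is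
    C(n-p, n-q) * det (A * B) ([sum_det_increasing]).  The special case p = q is
    the Cauchy-Binet formula.  Applied twice, it shows that the sum of
    the principal q-minors of B * A equals that of A * B
    ([sum_principal_minors]); as A * B = 1, this is the number C(p, q) of index
    sets.

    Since the Grassmann angle is defined through principal angles, their existence
    is part of the proof ([principal_angles_exist]).  With g the orthogonal
    projection onto W, the Hermitian form (u, v) |-> <g u, g v> on V is
    diagonalised by an orthonormal basis e of V; normalising the nonzero vectors
    g e_i and completing them to an orthonormal basis of W gives the other
    principal basis.  This argument is the same over both scalar fields once
    Hermitian matrices have eigenvalues in the field; over the reals this is
    where complex spectral theory enters ([real_symmetric_eigenvalue]). *)

(** * Sums of minors *)

Section Minors.
Variable K : comNzRingType.

(** Multilinearity of the determinant in the rows of the product: row i of A * B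
    is a combination of the rows of B, and f records the row of B chosen for
    each i. *)
Lemma det_mulmx_ffun m n (A : 'M[K]_(m, n)) (B : 'M[K]_(n, m)) :
  \det (A *m B) =
  \sum_(f : {ffun 'I_m -> 'I_n}) (\prod_i A i (f i)) * \det (rowsub f B).
Proof.
transitivity (\sum_(s : 'S_m) \sum_(f : {ffun 'I_m -> 'I_n})
    (-1) ^+ s * \prod_i (A i (f i) * B (f i) (s i))).
  apply: eq_bigr => s _; rewrite -big_distrr /=; congr (_ * _).
  rewrite -(bigA_distr_bigA (fun i k => A i k * B k (s i))).
  by apply: eq_bigr => i _; rewrite mxE.
rewrite exchange_big; apply: eq_bigr => f _; rewrite big_distrr /=.
apply: eq_bigr => s _; rewrite big_split /= mulrCA; congr (_ * (_ * _)).
by apply: eq_bigr => i _; rewrite mxE.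
Qed.

Lemma increasing_uniq n q (t : q.-tuple 'I_n) :
  t \in increasing_tuples n q -> uniq t.
Proof.
rewrite inE => t_sorted; rewrite -(map_inj_uniq val_inj).
exact: sorted_uniq ltn_trans ltnn _ t_sorted.
Qed.

(** Passing to complements turns the index sets of size q containing T into the
    subsets of size n - q of the complement of T; hence this form of the binomial
    coefficient rather than C(n - #|T|, q - #|T|). *)
Lemma card_increasing_tuples_sup n q (T : {set 'I_n}) : (q <= n)%N ->
  #|[set t in increasing_tuples n q | T \subset t]| = 'C(n - #|T|, n - q).
Proof.
move=> le_qn; pose compl (t : q.-tuple 'I_n) := ~: [set x in t].
have -> : (n - #|T|)%N = #|~: T| by rewrite [RHS]cardsCs finset.setCK card_ord.
rewrite -cards_draws -(card_in_imset (f := compl)); last first.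
  move=> s t; rewrite !inE => /andP[s_inc _] /andP[t_inc _] /finset.setC_inj eq_st.
  apply/val_inj/(inj_map val_inj).
  apply: (irr_sorted_eq ltn_trans ltnn) => // x; apply/mapP/mapP => -[y y_in ->];
    exists y => //; by move/finset.setP/(_ y): eq_st; rewrite !inE y_in.
apply: eq_card => S; rewrite !inE; apply/imsetP/andP => [[t]|[sST /eqP cardS]].
  rewrite inE => /andP[t_inc sTt] ->; split.
    rewrite finset.setCS; apply/fintype.subsetP => x /(fintype.subsetP sTt).
    by rewrite inE.
  rewrite cardsCs finset.setCK card_ord cardsE.
  by move/increasing_uniq/card_uniqP: t_inc => ->; rewrite size_tuple.
have sizeS : size (enum (~: S)) == q.
  by rewrite -cardE cardsCs finset.setCK card_ord cardS subKn.
exists (Tuple sizeS); last by apply/finset.setP=> x; rewrite !inE mem_enum inE negbK.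
rewrite inE; apply/andP; split; last first.
  apply/fintype.subsetP => x xT; rewrite mem_enum inE.
  by apply/negP => /(fintype.subsetP sST); rewrite inE xT.
rewrite inE /= sorted_map/(enum (~: S)) -enumT; apply: sorted_filter.
  by move=> y x z; apply: ltn_trans.
by rewrite -sorted_map val_enum_ord iota_ltn_sorted.
Qed.

(** Selecting the columns in t restricts the multilinear expansion of det (A * B)
    to the maps with values in t.  After exchanging the sums, each injective map is
    counted once for every t containing its image, and the other maps contribute
    0 because they repeat a row of B. *)
Theorem sum_det_increasing p q n (A : 'M[K]_(p, n)) (B : 'M[K]_(n, p)) :
  (q <= n)%N ->
  \sum_(t in increasing_tuples n q)
    \det (colsub (tnth t) A *m rowsub (tnth t) B)
  = 'C(n - p, n - q)%:R * \det (A *m B).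
Proof.
move=> le_qn; have minorE t : t \in increasing_tuples n q ->
    \det (colsub (tnth t) A *m rowsub (tnth t) B) =
    \sum_(f : {ffun 'I_p -> 'I_n} | f @: 'I_p \subset t)
       (\prod_i A i (f i)) * \det (rowsub f B).
  move=> /increasing_uniq t_uniq.
  (* Erasing the columns outside t, rather than deleting them, keeps the size n
     and lets the expansion be compared term by term with that of A * B. *)
  have -> : colsub (tnth t) A *m rowsub (tnth t) B =
            (\matrix_(i, k) ((k \in t)%:R * A i k)) *m B.
    apply/matrixP => i j; rewrite !mxE.
    transitivity (\sum_(k in t) A i k * B k j).
      rewrite -big_uniq // big_tuple.
      by apply: eq_bigr => l _; rewrite !mxE.
    rewrite big_mkcond; apply: eq_bigr => k _.
    by rewrite mxE; case: ifP; rewrite ?mul1r ?mul0r.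
  rewrite det_mulmx_ffun [RHS]big_mkcond; apply: eq_bigr => f _.
  case: ifPn => [/fintype.subsetP sft|].
    congr (_ * _); apply: eq_bigr => i _.
    by rewrite mxE sft ?mul1r // imset_f.
  case/subsetPn => _ /imsetP[i _ ->] /negbTE f_notin.
  by rewrite (bigD1 i) //= mxE f_notin !mul0r.
rewrite (eq_bigr _ minorE) det_mulmx_ffun big_distrr /=.
rewrite (exchange_big_dep predT) //=; apply: eq_bigr => f _.
rewrite sumr_const mulr_natl.
have [/injectiveP f_inj|/injectivePn[i [j ne_ij eq_f]]] := boolP (injectiveb f).
  congr (_ *+ _); rewrite -[in RHS](card_ord p) -(card_imset _ f_inj).
  by rewrite -card_increasing_tuples_sup //; apply: eq_card => t; rewrite [RHS]inE.
rewrite (determinant_alternate ne_ij) ?mulr0 ?mul0rn // => k.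
by rewrite !mxE eq_f.
Qed.

(** The case p = q of the previous count: the factor is C(m - q, m - q) = 1 and the
    minors are determinants of square matrices. *)
Corollary cauchy_binet q m (A : 'M[K]_(q, m)) (B : 'M[K]_(m, q)) :
  (q <= m)%N ->
  \det (A *m B) = \sum_(t in increasing_tuples m q)
     \det (colsub (tnth t) A) * \det (rowsub (tnth t) B).
Proof.
move=> le_qm; rewrite -[LHS]mul1r -[1]/(1%:R) -(binn (m - q)).
by rewrite -sum_det_increasing //; apply: eq_bigr => t _; apply: det_mulmx.
Qed.

(** The Cauchy-Binet formula turns both sides into the double sum of the
    products det A_(s,t) * det B_(t,s). *)
Theorem sum_principal_minors p q n (A : 'M[K]_(p, n)) (B : 'M[K]_(n, p)) :
  (q <= n)%N -> (q <= p)%N ->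
  \sum_(t in increasing_tuples n q)
    \det (rowsub (tnth t) B *m colsub (tnth t) A)
  = \sum_(t in increasing_tuples p q)
    \det (rowsub (tnth t) A *m colsub (tnth t) B).
Proof.
move=> le_qn le_qp.
under eq_bigr do rewrite cauchy_binet //.
under [RHS]eq_bigr do rewrite cauchy_binet //.
rewrite exchange_big; apply: eq_bigr => s _; apply: eq_bigr => t _.
by rewrite mulrC; congr (_ * _); congr (\det _); apply/matrixP => i j; rewrite !mxE.
Qed.
End Minors.

(** * Gram matrices and orthogonal projections *)

Section InnerProduct.
Variables (F : numFieldType) (theta : {rmorphism F -> F}).
Variables (X : vectType F) (dot : {dot X for theta}).
Implicit Types (u v w : X) (s t b : seq X) (V W : {vspace X}).

Lemma dotC u v : theta (dot u v) = dot v u.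
Proof. by rewrite [RHS]hermC expr0 mul1r. Qed.

Lemma dotZl a u v : dot (a *: u) v = a * dot u v.
Proof. exact: linearZl_LR. Qed.

Lemma dotDl u v w : dot (u + v) w = dot u w + dot v w.
Proof. exact: linearDl. Qed.

Lemma dotBl u v w : dot (u - v) w = dot u w - dot v w.
Proof. exact: linearBl. Qed.

Lemma dotBr u v w : dot u (v - w) = dot u v - dot u w.
Proof. exact: linearBr. Qed.

Lemma dotZr a u v : dot u (a *: v) = theta a * dot u v.
Proof. exact: linearZr_LR. Qed.

Lemma dot_suml I (r : seq I) (f : I -> X) v :
  dot (\sum_(i <- r) f i) v = \sum_(i <- r) dot (f i) v.
Proof. exact: linear_sumlz. Qed.

Lemma dot_sumr I (r : seq I) u (f : I -> X) :
  dot u (\sum_(i <- r) f i) = \sum_(i <- r) dot u (f i).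
Proof. exact: linear_sumr. Qed.

Lemma dot_ge0 u : 0 <= dot u u.
Proof.
have [->|u_neq0] := eqVneq u 0; first by rewrite linear0r.
exact/ltW/neq0_dnorm_gt0.
Qed.

Lemma dot_eq0 u : (dot u u == 0) = (u == 0).
Proof.
have [->|u_neq0] := eqVneq u 0; first by rewrite linear0r eqxx.
by rewrite gt_eqF // neq0_dnorm_gt0.
Qed.

Lemma orthogonal_pairP s : pairwise_orthogonal dot s ->
  uniq s /\ {in s &, forall u v, u != v -> dot u v = 0}.
Proof.
rewrite /pairwise_orthogonal => /andP[].
elim: s => //= v s IHs; rewrite inE negb_or eq_sym andbT.
move=> /andP[v_neq0 /IHs{}IHs] /andP[/allP v_ortho /IHs[s_uniq s_ortho]].
split=> [|x y].
  by rewrite s_uniq andbT; apply/negP => /v_ortho/=; rewrite dot_eq0 (negbTE v_neq0).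
rewrite !inE => /predU1P[->|xs] /predU1P[->|ys]; rewrite ?eqxx //.
- by move=> _; apply/eqP/v_ortho.
- by move=> _; rewrite -dotC; move/eqP: (v_ortho x xs) => ->; rewrite rmorph0.
- exact: s_ortho.
Qed.

Lemma dot_orthonormalP s :
  reflect (uniq s /\ {in s &, forall u v, dot u v = (u == v)%:R})
          (orthonormal dot s).
Proof.
apply: (iffP idP) => [|[]].
  rewrite orthonormalE => /andP[/allP s_unit /orthogonal_pairP[s_uniq s_ortho]].
  split=> // u v us vs; have [<-|] := eqVneq u v; first exact/eqP/s_unit.
  exact: s_ortho.
elim: s => //= u s IHs /andP[us s_uniq] s_dot.
rewrite /orthonormal /= s_dot ?mem_head // !eqxx andbT /= andbCA.
rewrite [X in _ && X]IHs // ?andbT; last first.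
  by move=> x y xs ys; rewrite s_dot // inE ?xs ?ys orbT.
apply/allP => v vs /=; rewrite s_dot ?inE ?eqxx ?vs ?orbT //.
by have [eq_uv|] := eqVneq u v; first by rewrite eq_uv vs in us.
Qed.

Lemma orthonormal_map (T : eqType) (h : T -> X) (r : seq T) : uniq r ->
    {in r &, forall x y, dot (h x) (h y) = (x == y)%:R} ->
  orthonormal dot (map h r).
Proof.
move=> r_uniq h_dot.
have h_inj : {in r &, injective h}.
  move=> x y xr yr eq_h; have := h_dot x y xr yr; rewrite eq_h h_dot // eqxx.
  by case: eqP => // _ /eqP; rewrite oner_eq0.
apply/dot_orthonormalP; split; first by rewrite map_inj_in_uniq.
by move=> _ _ /mapP[x xr ->] /mapP[y yr ->]; rewrite h_dot // (inj_in_eq h_inj).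
Qed.

Lemma orthonormal_expand s u : orthonormal dot s -> u \in << s >>%VS ->
  u = \sum_(x <- s) dot u x *: x.
Proof.
move=> /dot_orthonormalP[s_uniq s_dot] u_span.
rewrite [in LHS](coord_span (X := in_tuple s) u_span) (big_nth 0) big_mkord.
apply: eq_bigr => i _; congr (_ *: _).
rewrite {2}(coord_span (X := in_tuple s) u_span) dot_suml (bigD1 i) //= big1.
  by rewrite dotZl s_dot ?mem_nth // eqxx mulr1 addr0.
move=> j ne_ji; rewrite dotZl s_dot ?mem_nth // nth_uniq //.
by rewrite (negbTE (ne_ji : val j != val i)) mulr0.
Qed.

Lemma dot_orthonormal_free s : orthonormal dot s -> free s.
Proof.
move=> /dot_orthonormalP[s_uniq s_dot]; rewrite -(in_tupleE s).
apply/freeP => k k0 i; have /eqP := congr1 (dot^~ s`_i) k0.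
rewrite linear0l dot_suml (bigD1 i) //= big1 => [|j ne_ji]; last first.
  rewrite dotZl s_dot ?mem_nth // nth_uniq //.
  by rewrite (negbTE (ne_ji : val j != val i)) mulr0.
by rewrite dotZl s_dot ?mem_nth // eqxx mulr1 addr0 => /eqP.
Qed.

Definition gram p q s t : 'M[F]_(p, q) := \matrix_(i, j) dot s`_i t`_j.

Lemma nth_memv V s i : {subset s <= V} -> s`_i \in V.
Proof.
move=> sV; have [i_lt|i_ge] := ltnP i (size s); first exact/sV/mem_nth.
by rewrite nth_default // mem0v.
Qed.

Lemma mem_basis V b : basis_of V b -> {subset b <= V}.
Proof. by move=> b_basis x; apply: basis_mem. Qed.

Lemma size_basis_seq V b : basis_of V b -> size b = \dim V.
Proof. by move=> b_basis; rewrite -(size_basis (X := in_tuple b) b_basis). Qed.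

(** Parseval's identity: an orthonormal basis b of a space containing one of the
    two families can be inserted in the middle of their Gram matrix. *)
Lemma gram_insertr (p q r : nat) s t W b : orthonormal_basis dot W b -> \dim W = r ->
  {subset t <= W} -> gram p q s t = gram p r s b *m gram r q b t.
Proof.
move=> [b_basis b_orth] dimW tW; apply/matrixP => i j; rewrite !mxE.
have tj_W := nth_memv j tW; rewrite -(span_basis b_basis) in tj_W.
rewrite [in LHS](orthonormal_expand b_orth tj_W) dot_sumr (big_nth 0).
rewrite (size_basis_seq b_basis) dimW big_mkord; apply: eq_bigr => k _.
by rewrite !mxE dotZr dotC mulrC.
Qed.

Lemma gram_insertl (p q r : nat) s t V b : orthonormal_basis dot V b -> \dim V = r ->
  {subset s <= V} -> gram p q s t = gram p r s b *m gram r q b t.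
Proof.
move=> [b_basis b_orth] dimV sV; apply/matrixP => i j; rewrite !mxE.
have si_V := nth_memv i sV; rewrite -(span_basis b_basis) in si_V.
rewrite [in LHS](orthonormal_expand b_orth si_V) dot_suml (big_nth 0).
rewrite (size_basis_seq b_basis) dimV big_mkord; apply: eq_bigr => k _.
by rewrite !mxE dotZl.
Qed.

Lemma gram_orthonormal p b : orthonormal dot b -> size b = p ->
  gram p p b b = 1%:M.
Proof.
move=> /dot_orthonormalP[b_uniq b_dot] szb; apply/matrixP => i j.
by rewrite !mxE b_dot ?mem_nth ?szb // nth_uniq ?szb.
Qed.

(** Inserting f' in [gram a f] yields factors [gram f' f] and [gram f f'] that
    cancel in the middle; inserting a' yields outer factors whose determinants
    have product det (gram a a) = 1. *)
Lemma det_gram_change_basis (p q : nat) V W a a' f f' :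
  \dim V = p -> \dim W = q ->
  orthonormal_basis dot V a -> orthonormal_basis dot V a' ->
  orthonormal_basis dot W f -> orthonormal_basis dot W f' ->
  \det (gram p q a f *m gram q p f a) = \det (gram p q a' f' *m gram q p f' a').
Proof.
move=> dV dW aV a'V fW f'W.
have [aS a'S] := (mem_basis aV.1, mem_basis a'V.1).
have [fS f'S] := (mem_basis fW.1, mem_basis f'W.1).
rewrite (gram_insertl _ _ _ a'V dV aS) (gram_insertr _ _ _ a'V dV aS).
rewrite (gram_insertr p q a' f'W dW fS) (gram_insertl q p a' f'W dW fS).
have det1 : \det (gram p p a a') * \det (gram p p a' a) = 1.
  rewrite -det_mulmx -(gram_insertr _ _ _ a'V) // gram_orthonormal ?det1 //.
    exact: aV.2.
  by rewrite (size_basis_seq aV.1).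
rewrite -!mulmxA.
rewrite !(mulmxA (gram q q f' f)) -(gram_insertr _ _ _ fW dW f'S).
rewrite (gram_orthonormal f'W.2) ?mul1mx ?(size_basis_seq f'W.1) //.
by rewrite !mulmxA det_mulmx -mulmxA det_mulmx mulrAC det1 mul1r.
Qed.

(* orth_proj *)
Definition orth_proj b u := \sum_(x <- b) dot u x *: x.

Lemma orth_proj_is_linear b : linear (orth_proj b).
Proof.
move=> a u v; rewrite /orth_proj scaler_sumr -big_split /=; apply: eq_bigr => x _.
by rewrite dotDl scalerDl dotZl scalerA.
Qed.

HB.instance Definition _ b :=
  GRing.isLinear.Build F X X *:%R (orth_proj b) (orth_proj_is_linear b).

Lemma orth_proj_mem b u : orth_proj b u \in <<b>>%VS.
Proof.
by rewrite /orth_proj big_seq rpred_sum // => x xb; rewrite rpredZ ?memv_span.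
Qed.

Lemma dot_projl b u w : orthonormal dot b -> w \in <<b>>%VS ->
  dot (orth_proj b u) w = dot u w.
Proof.
move=> b_orth w_span; rewrite [in RHS](orthonormal_expand b_orth w_span).
rewrite [orth_proj b u]/orth_proj dot_suml dot_sumr; apply: eq_bigr => x _.
by rewrite dotZl dotZr dotC mulrC.
Qed.

Lemma dot_projr b u w : orthonormal dot b -> w \in <<b>>%VS ->
  dot w (orth_proj b u) = dot w u.
Proof. by move=> b_orth w_span; rewrite -dotC dot_projl // dotC. Qed.

(** Pythagoras for u = orth_proj u + (u - orth_proj u).  This is what makes the
    cosines of the principal angles at most 1. *)
Lemma orth_proj_norm b u : orthonormal dot b ->
  dot (orth_proj b u) (orth_proj b u) <= dot u u.
Proof.
move=> b_orth; rewrite -subr_ge0.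
suff -> : dot u u - dot (orth_proj b u) (orth_proj b u) =
          dot (u - orth_proj b u) (u - orth_proj b u).
  exact: dot_ge0.
have proj_u : dot u (orth_proj b u) = dot (orth_proj b u) (orth_proj b u).
  by rewrite dot_projl ?orth_proj_mem.
have u_proj : dot (orth_proj b u) u = dot (orth_proj b u) (orth_proj b u).
  by rewrite dot_projr ?orth_proj_mem.
by rewrite dotBl !dotBr proj_u u_proj subrr subr0.
Qed.

End InnerProduct.

(** * Principal angles *)

Lemma acos_itv_pihalf (R : realType) (x : R) : 0 <= x <= 1 ->
  0 <= acos x <= pi / 2.
Proof.
move=> /andP[x_ge0 x_le1].
have x_itv : -1 <= x <= 1 by rewrite x_le1 andbT (le_trans _ x_ge0) // lerN10.
rewrite acos_ge0 //= leNgt; apply/negP => acos_gt.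
have pihalf_itv : (pi / 2 : R) \in `[0, pi].
  rewrite in_itv /= divr_ge0 ?pi_ge0 //=.
  by rewrite ler_pdivrMr // ler_peMr ?pi_ge0 // ler1n.
have acos_in : acos x \in `[0, pi]%R by rewrite in_itv /= acos_ge0 ?acos_lepi.
have : cos (acos x) < cos (pi / 2) by rewrite ltr_cos.
by rewrite cos_pihalf acosK ?in_itv // ltNge x_ge0.
Qed.

(** The real and the complex case share everything below.  They differ only in the
    proof of [hermitian_eigenvalue]: over the complex numbers every square matrix
    has an eigenvalue, over the reals symmetry is essential. *)
Section PrincipalAngles.
Variables (R : realType) (F : numFieldType).
Variables (iota : {rmorphism R -> F}) (theta : {rmorphism F -> F}).
Hypothesis theta_iota : forall r, theta (iota r) = iota r.
Hypothesis iota_ge0 : forall x, 0 <= x -> exists2 r, 0 <= r & x = iota r.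
Hypothesis hermitian_eigenvalue : forall n (H : 'M[F]_n.+1),
  (forall i j, theta (H i j) = H j i) -> exists a, eigenvalue H a.
Variables (X : vectType F) (dot : {dot X for theta}).
Implicit Types (u v w : X) (s t b : seq X) (V W : {vspace X}).

Lemma dot_sqrt u : exists2 r, 0 <= r & dot u u = iota r ^+ 2.
Proof.
have [r r_ge0 ->] := iota_ge0 (dot_ge0 dot u).
by exists (Num.sqrt r); rewrite ?sqrtr_ge0 // -rmorphXn sqr_sqrtr.
Qed.

Lemma normalizable u : u != 0 ->
  exists2 a, a != 0 & dot (a *: u) (a *: u) = 1.
Proof.
have [r _ dot_u] := dot_sqrt u; rewrite -(dot_eq0 dot) dot_u expf_eq0 /= => r_neq0.
exists (iota r^-1); first by rewrite fmorphV invr_eq0.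
rewrite dotZl dotZr theta_iota dot_u fmorphV mulrA -expr2 -exprMn.
by rewrite mulVf // expr1n.
Qed.

(** A possible first vector of an orthonormal basis of V whose members are pairwise
    related by Q. *)
Definition orthonormal_head (Q : rel X) V e :=
  [/\ e \in V, dot e e = 1 & {in V, forall v, dot v e = 0 -> Q e v}].

(** Split off a head e and continue in the orthogonal complement of e in V.
    The trivial relation Q gives the Gram-Schmidt process; orthogonality of the
    images under a linear map gives simultaneous diagonalisation. *)
Lemma orthonormal_basis_exists (Q : rel X) V :
    (forall U, (U <= V)%VS -> U != 0%VS -> exists e, orthonormal_head Q U e) ->
  exists2 s, orthonormal_basis dot V s & pairwise Q s.
Proof.
move: {-1}(\dim V) (erefl (\dim V)) => m; elim: m V => [|m IHm] V dimV Qhead.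
  exists [::] => //; split=> //; rewrite basisEfree nil_free /= dimV span_nil.
  by rewrite sub0v.
have V_neq0 : V != 0%VS by rewrite -dimv_eq0 dimV.
have [e [eV e_unit eQ]] := Qhead V (subvv V) V_neq0.
pose U := (V :&: orthov dot <[e]>)%VS.
have dimU : \dim U = m.
  have e_neq0 : dot e e != 0 by rewrite e_unit oner_eq0.
  by rewrite -eq_dim_orthov1 ?dimV //; apply/mem_orthovPn; exists e.
have memU v : v \in U -> v \in V /\ dot v e = 0.
  by rewrite memv_cap mem_orthov1 => /andP[vV /eqP ve].
have UV : (U <= V)%VS by rewrite capvSl.
have [|s [s_basis s_orth] sQ] := IHm U dimU.
  by move=> U' U'U; apply: Qhead; apply: subv_trans U'U UV.
have sU := mem_basis s_basis.
have es_orth : orthonormal dot (e :: s).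
  move: s_orth; rewrite /orthonormal /= e_unit eqxx andbT /= => /andP[-> ->].
  rewrite /= andbT; apply/allP => v vs /=.
  by have [_ ve] := memU v (sU v vs); rewrite -(dotC dot) ve rmorph0.
exists (e :: s); last first.
  by rewrite /= sQ andbT; apply/allP => v /sU/memU[vV ve]; apply: eQ.
split=> //; rewrite basisEfree (dot_orthonormal_free es_orth) /=.
rewrite (size_basis_seq s_basis) dimU dimV leqnn andbT.
apply/span_subvP => v; rewrite inE => /predU1P[->|/sU/memU[]] //.
Qed.

Lemma gram_schmidt V : exists s, orthonormal_basis dot V s.
Proof.
have [U _ U_neq0|s sV _] := @orthonormal_basis_exists (fun _ _ => true) V.
  have [|a _ a_unit] := normalizable (u := vpick U); first by rewrite vpick0.
  by exists (a *: vpick U); split; rewrite ?rpredZ ?memv_pick.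
by exists s.
Qed.

(** Complete s by an orthonormal basis of its orthogonal complement in W. *)
Lemma orthonormal_completion W s : orthonormal dot s -> {subset s <= W} ->
  exists s', orthonormal_basis dot W (s ++ s').
Proof.
move=> s_orth sW; have [s' [s'_basis s'_orth]] :=
  gram_schmidt (W :&: orthov dot << s >>)%VS.
have s'U := mem_basis s'_basis.
have memU v : v \in (W :&: orthov dot << s >>)%VS ->
    v \in W /\ {in s, forall x, dot v x = 0}.
  rewrite memv_cap => /andP[vW /mem_orthovP v_ortho]; split=> // x xs.
  by rewrite v_ortho ?memv_span.
have ss'_orth : orthonormal dot (s ++ s').
  have [s_uniq s_dot] := dot_orthonormalP _ _ s_orth.
  have [s'_uniq s'_dot] := dot_orthonormalP _ _ s'_orth.
  have cross v x : v \in s' -> x \in s -> dot v x = 0.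
    by move=> /s'U/memU[_]; apply.
  apply/dot_orthonormalP; split.
    rewrite cat_uniq s_uniq s'_uniq andbT /=; apply/hasPn => v vs'.
    apply/negP => vs; have := s_dot v v vs vs.
    by rewrite cross // eqxx => /esym/eqP; rewrite oner_eq0.
  have neq v x : v \in s' -> x \in s -> (v == x) = false.
    move=> vs' xs; apply/eqP => eq_vx; have := cross v x vs' xs.
    by rewrite eq_vx s_dot // eqxx => /eqP; rewrite oner_eq0.
  move=> u v; rewrite !mem_cat => /orP[us|us'] /orP[vs|vs'].
  - exact: s_dot.
  - by rewrite -dotC cross // rmorph0 eq_sym neq.
  - by rewrite cross // neq.
  - exact: s'_dot.
exists s'; split=> //; rewrite basisEfree (dot_orthonormal_free ss'_orth) /=.
apply/andP; split.
  apply/span_subvP => v; rewrite mem_cat => /orP[/sW //|/s'U/memU[]] //.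
have <- := eqP (dot_orthonormal_free ss'_orth).
apply/dimvS/subvP => w wW; rewrite -(subrK (orth_proj dot s w) w) addrC span_cat.
apply: memv_add; first exact: orth_proj_mem.
rewrite (span_basis s'_basis) memv_cap; apply/andP; split; last first.
  apply/mem_orthovP => x xs.
  suff: dot (w - orth_proj dot s w) x = 0 by [].
  by rewrite dotBl dot_projl // subrr.
apply: rpredB => //.
have /subvP: (<< s >> <= W)%VS by apply/span_subvP.
by apply; apply: orth_proj_mem.
Qed.

(** Let H be the matrix of the Hermitian form <g u, g v> in an orthonormal basis of
    V and e the vector with coordinates an eigenvector of H.  Then
    <g e, g v> = l <e, v> for all v in V, so that the image of e is orthogonal to
    the image of every v orthogonal to e. *)
Lemma eigenvector_head (g : {linear X -> X}) V : V != 0%VS ->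
  exists e, orthonormal_head (fun u v => dot (g u) (g v) == 0) V e.
Proof.
move=> V_neq0; have [b [b_basis b_orth]] := gram_schmidt V.
have [m dimV] : exists m, \dim V = m.+1.
  by exists (\dim V).-1; rewrite prednK // lt0n dimv_eq0.
have szb : size b = m.+1 by rewrite (size_basis_seq b_basis).
have [b_uniq b_dot] := dot_orthonormalP _ _ b_orth.
have [|l /eigenvalueP[x xH x_neq0]] :=
    @hermitian_eigenvalue m (\matrix_(i, j) dot (g b`_i) (g b`_j)).
  by move=> i j; rewrite !mxE dotC.
pose e := \sum_(i < m.+1) x 0 i *: b`_i.
have dot_eb (j : 'I_m.+1) : dot e b`_j = x 0 j.
  rewrite dot_suml (bigD1 j) //= big1 => [|i ne_ij];
    rewrite dotZl b_dot ?mem_nth ?szb //.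
    by rewrite eqxx mulr1 addr0.
  by rewrite nth_uniq ?szb // (negbTE (ne_ij : val i != val j)) mulr0.
have dot_geb (j : 'I_m.+1) : dot (g e) (g b`_j) = l * dot e b`_j.
  have /matrixP/(_ 0 j) := xH; rewrite !mxE dot_eb => <-.
  rewrite linear_sum dot_suml; apply: eq_bigr => i _.
  by rewrite linearZ /= dotZl mxE.
have e_neq0 : e != 0.
  apply: contra_neq x_neq0 => e0; apply/rowP => j.
  by rewrite -dot_eb e0 linear0l mxE.
have bV := mem_basis b_basis.
have eV : e \in V by rewrite rpred_sum // => i _; rewrite rpredZ // nth_memv.
have [a a_neq0 a_unit] := normalizable e_neq0.
clearbody e.
exists (a *: e); split; rewrite ?rpredZ // => v vV; rewrite dotZr => /eqP.
rewrite mulf_eq0 fmorph_eq0 (negbTE a_neq0) /= => /eqP dot_ve.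
have v_exp : v = \sum_(j < m.+1) dot v b`_j *: b`_j.
  have v_span : v \in <<b>>%VS by rewrite (span_basis b_basis).
  rewrite {1}(orthonormal_expand b_orth v_span).
  by rewrite (big_nth 0) szb big_mkord.
apply/eqP; rewrite linearZ /= dotZl {1}v_exp linear_sum dot_sumr.
transitivity (a * (l * dot e v)).
  congr (_ * _); rewrite [in RHS]v_exp dot_sumr mulr_sumr; apply: eq_bigr => j _.
  by rewrite linearZ /= !dotZr dot_geb mulrCA.
by rewrite -dotC dot_ve rmorph0 !mulr0.
Qed.

(** The singular value decomposition of the projection g of V to W.  The basis e of
    V has pairwise orthogonal images under g and theta_i := acos |g e_i|.  Sorting
    e by angle puts the vectors with g e_i = 0 last, so that the normalised nonzero
    images are an initial segment f1 of a basis f of W, with the same indices as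
    in e.  Then g e_i = cos theta_i f_i for every i, whence
    <f_j, e_i> = <f_j, g e_i> = delta_ij cos theta_i. *)
Lemma principal_angles_exist V W : (\dim V <= \dim W)%N ->
  exists t : seq R, is_principal_angles iota dot V W t.
Proof.
move=> le_VW; have [b [b_basis b_orth]] := gram_schmidt W.
pose g := orth_proj dot b.
have gW u : g u \in W by rewrite -(span_basis b_basis) orth_proj_mem.
have [//|e0 [e0_basis e0_orth] e0_axes] :=
  @orthonormal_basis_exists (fun u v => dot (g u) (g v) == 0) V.
  by move=> U _; apply: eigenvector_head.
have nrm_ex u : exists r : R, 0 <= r /\ dot (g u) (g u) = iota r ^+ 2.
  by have [r r_ge0 dot_gu] := dot_sqrt (g u); exists r.
have [nrm nrmP] := boolp.choice nrm_ex.
pose ang u := acos (nrm u).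
pose e := sort (fun u v => ang u <= ang v) e0.
have e_perm : perm_eq e e0 by rewrite perm_sort.
have [e0_uniq e0_dot] := dot_orthonormalP _ _ e0_orth.
have e_orth : orthonormal dot e.
  apply/dot_orthonormalP; split; first by rewrite (perm_uniq e_perm).
  by move=> u v; rewrite !(perm_mem e_perm); apply: e0_dot.
have e_basis : basis_of V e by rewrite (perm_basis _ e_perm).
have sze : size e = \dim V := size_basis_seq e_basis.
have [e_uniq e_dot] := dot_orthonormalP _ _ e_orth.
have e_axes : {in e &, forall u v, u != v -> dot (g u) (g v) = 0}.
  have Q_lt i j : (i < j)%N -> (j < size e0)%N -> dot (g e0`_i) (g e0`_j) = 0.
    move=> lt_ij j_lt; apply/eqP; apply: (pairwiseP 0 e0_axes) => //.
    exact: ltn_trans lt_ij j_lt.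
  move=> u v; rewrite !(perm_mem e_perm) => ue ve.
  rewrite -{1}(nth_index 0 ue) -{1}(nth_index 0 ve) nth_uniq ?index_mem //.
  rewrite -{2}(nth_index 0 ue) -{2}(nth_index 0 ve).
  rewrite neq_ltn => /orP[] lt_uv; first by rewrite Q_lt ?index_mem.
  by rewrite -dotC Q_lt ?index_mem // rmorph0.
have nrm_itv u : u \in e -> 0 <= nrm u <= 1.
  move=> ue; have [-> dot_gu] := nrmP u; rewrite /=.
  have := orth_proj_norm u b_orth; rewrite -/g dot_gu e_dot // eqxx.
  rewrite -subr_ge0 => /iota_ge0[s s_ge0].
  rewrite -rmorphXn -(rmorph1 iota) -rmorphB => /fmorph_inj eq_s.
  by rewrite -(expr_le1 (n := 2)) ?(nrmP u).1 // -subr_ge0 eq_s.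
have ang_itv u : u \in e -> 0 <= ang u <= pi / 2.
  by move/nrm_itv/acos_itv_pihalf.
have cos_ang u : u \in e -> cos (ang u) = nrm u.
  move/nrm_itv/andP => [ge0 le1]; rewrite acosK // in_itv /= le1 andbT.
  by rewrite (le_trans _ ge0) // lerN10.
have ang_sorted : sorted <=%R (map ang e).
  by rewrite sorted_map; apply: sort_sorted => u v; apply: le_total.
(* The images of the first k vectors are exactly those that do not vanish. *)
pose k := find (fun u => nrm u == 0) e.
have nrm_lt i : (i < k)%N -> nrm e`_i != 0.
  by move/(before_find 0) => /negbT.
have nrm_ge i : (i < size e)%N -> (k <= i)%N -> nrm e`_i = 0.
  move=> i_lt le_ki; have k_lt := leq_ltn_trans le_ki i_lt.
  have /eqP nrm_k : nrm e`_k == 0.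
    have := @nth_find _ 0 (fun u => nrm u == 0) e; apply.
    by rewrite has_find.
  have := le_sorted_leq_nth 0 ang_sorted _ _ le_ki.
  rewrite !inE !size_map !(nth_map 0) // => /(_ k_lt i_lt).
  rewrite {1}/ang nrm_k acos0 => ang_ge.
  have ei := mem_nth 0 i_lt; rewrite -cos_ang // -cos_pihalf; congr cos.
  by apply/eqP; rewrite eq_le ang_ge; case/andP: (ang_itv _ ei) => _ ->.
pose f1 := [seq (iota (nrm u))^-1 *: g u | u <- take k e].
have f1_orth : orthonormal dot f1.
  apply: orthonormal_map => [|u v u_in v_in]; first exact: take_uniq.
  have [ue ve] := (mem_take u_in, mem_take v_in).
  rewrite dotZl dotZr fmorphV theta_iota.
  have [->|] := eqVneq u v; last by move/e_axes->; rewrite // !mulr0.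
  have nrm_v : iota (nrm v) != 0.
    have v_lt : (index v (take k e) < k)%N.
      by rewrite (leq_trans (n := size (take k e))) ?index_mem // size_take geq_minl.
    by rewrite fmorph_eq0 -(nth_index 0 v_in) nth_take // nrm_lt.
  by rewrite (nrmP v).2 expr2 mulrA mulVf // mul1r mulVf.
have f1W : {subset f1 <= W}.
  by move=> _ /mapP[u _ ->]; rewrite rpredZ.
have [f2 [f_basis f_orth]] := orthonormal_completion f1_orth f1W.
have [f_uniq f_dot] := dot_orthonormalP _ _ f_orth.
pose f := f1 ++ f2.
have szf : size f = \dim W := size_basis_seq f_basis.
have g_e i : (i < size e)%N -> g e`_i = iota (nrm e`_i) *: f`_i.
  move=> i_lt; have [i_ge|lt_ik] := leqP k i.
    rewrite nrm_ge // rmorph0 scale0r; apply/eqP.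
    by rewrite -(dot_eq0 dot) (nrmP _).2 nrm_ge // rmorph0 expr0n.
  have k_le : (k <= size e)%N by apply: find_size.
  rewrite nth_cat size_map size_takel // lt_ik (nth_map 0) ?size_takel //.
  by rewrite nth_take // scalerA mulfV ?scale1r // fmorph_eq0 nrm_lt.
exists (map ang e); split=> //.
- by rewrite size_map sze (minn_idPl le_VW).
- by move=> _ /mapP[u ue ->]; apply: ang_itv.
exists e, f; split=> // i j i_lt j_lt.
have fW := mem_basis f_basis.
rewrite -(dot_projr (dot := dot) _ b_orth) ?(span_basis b_basis) ?nth_memv //.
rewrite -/(g _) g_e ?sze // dotZr theta_iota.
rewrite f_dot ?mem_nth ?szf ?(leq_trans i_lt) // nth_uniq ?szf ?(leq_trans i_lt) //.
rewrite (nth_map 0) ?sze // cos_ang ?mem_nth ?sze // eq_sym.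
by case: eqP; rewrite ?mulr1 ?mulr0.
Qed.

(** In principal bases the Gram matrix is diagonal with entries cos theta_i, and the
    determinant depends only on the subspaces. *)
Lemma cos2_grassmann_angle (p q : nat) V W a f :
    \dim V = p -> \dim W = q -> (p <= q)%N ->
    orthonormal_basis dot V a -> orthonormal_basis dot W f ->
  iota (cos (grassmann_angle iota dot V W) ^+ 2) =
  \det (gram dot p q a f *m gram dot q p f a).
Proof.
move=> dimV dimW le_pq aV fW; rewrite /grassmann_angle.
have [V0|V_neq0] := eqVneq V 0%VS.
  have p0 : p = 0 by rewrite -dimV V0 dimv0.
  by subst p; rewrite p0 det_mx00 cos0 expr1n rmorph1.
have [W0|W_neq0] := eqVneq W 0%VS.
  by rewrite -dimv_eq0 dimV -leqn0 (leq_trans le_pq) // -dimW W0 dimv0 in V_neq0.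
rewrite dimV dimW le_pq.
have /(xgetPex [::]) : exists t : seq R, is_principal_angles iota dot V W t.
  by apply: principal_angles_exist; rewrite dimV dimW.
rewrite -/(principal_angles _ _ _ _); set t := principal_angles _ _ _ _.
case=> szt _ t_itv [e [f' [eV f'W angles]]].
rewrite dimV dimW (minn_idPl le_pq) in szt angles.
have cos_itv x : x \in t -> 0 <= cos x <= 1.
  move/t_itv/andP => [x_ge0 x_le]; rewrite cos_le1 andbT cos_ge0_pihalf //.
  by rewrite x_le (le_trans _ x_ge0) // oppr_le0 divr_ge0 ?pi_ge0.
have prod_itv : 0 <= \prod_(x <- t) cos x <= 1.
  rewrite big_seq prodr_ge0 => [/=|x /cos_itv/andP[]//].
  exact: Num.Theory.prodr_ile1.
rewrite acosK; last first.
  case/andP: prod_itv => ge0 le1; rewrite in_itv /= le1 andbT.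
  by rewrite (le_trans _ ge0) // lerN10.
rewrite (det_gram_change_basis dimV dimW aV eV fW f'W).
pose c i := iota (cos t`_i).
have -> : gram dot p q e f' *m gram dot q p f' e = diag_mx (\row_(i < p) c i ^+ 2).
  apply/matrixP => i j; rewrite !mxE.
  have lt_iq : (i < q)%N by apply: leq_trans le_pq.
  rewrite (bigD1 (Ordinal lt_iq)) //= big1 => [|k ne_ki]; rewrite !mxE.
    rewrite addr0 -[dot e`_i _]dotC !angles // eqxx theta_iota.
    rewrite -/(c _) [(j == i :> nat)]eq_sym -[_ == _ :> nat]/(i == j).
    by case: eqP => [->|_]; rewrite ?mulr1n ?mulr0n ?mulr0 // -expr2.
  rewrite -[dot e`_i _]dotC angles // ifN ?rmorph0 ?mul0r //.
  by rewrite eq_sym.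
rewrite det_diag rmorphXn rmorph_prod (big_nth 0) szt big_mkord -prodrXl.
by apply: eq_bigr => i _; rewrite mxE.
Qed.

(** * Coordinate subspaces *)

(** Normalising the members of an orthogonal basis leaves its coordinate subspaces
    unchanged. *)
Lemma orthonormal_coordinates (n : nat) (w : n.-tuple X) :
    orthogonal_basis dot {:X} w ->
  exists2 u : n.-tuple X, orthonormal dot u &
    forall q (i : q.-tuple 'I_n), coordinate_subspace w i = coordinate_subspace u i.
Proof.
move=> [_ w_orth]; have [w_uniq w_dot] := orthogonal_pairP w_orth.
have w_neq0 k : tnth w k != 0.
  by move: w_orth => /andP[/memPn w0 _]; rewrite w0 ?mem_tnth.
have normal k : exists a, a != 0 /\ dot (a *: tnth w k) (a *: tnth w k) = 1.
  by have [a a_neq0 a_unit] := normalizable (w_neq0 k); exists a.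
have [a aP] := boolp.choice normal.
exists [tuple a k *: tnth w k | k < n].
  apply: orthonormal_map => [|k l _ _]; first exact: enum_uniq.
  have [<-|ne_kl] := eqVneq k l; first exact: (aP k).2.
  rewrite dotZl dotZr w_dot ?mem_tnth ?mulr0 //.
  by apply: contra ne_kl => /eqP eq_w; apply/eqP/(elimT (tuple_uniqP w) w_uniq).
move=> q i; rewrite /coordinate_subspace; apply/eqP; rewrite eqEsubv.
apply/andP; split; apply/span_subvP => _ /mapP[k ki ->].
  have -> : tnth w k = (a k)^-1 *: (a k *: tnth w k).
    by rewrite scalerA mulVf ?scale1r ?(aP k).1.
  by rewrite rpredZ // memv_span //; apply/mapP; exists k; rewrite ?tnth_mktuple.
by rewrite tnth_mktuple rpredZ // memv_span //; apply/mapP; exists k.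
Qed.

Lemma coordinate_orthonormal_basis (n q : nat) (u : n.-tuple X) (i : q.-tuple 'I_n) :
    orthonormal dot u -> uniq i ->
  orthonormal_basis dot (coordinate_subspace u i) [seq tnth u k | k <- i].
Proof.
move=> /dot_orthonormalP[u_uniq u_dot] i_uniq.
have ui_orth : orthonormal dot [seq tnth u k | k <- i].
  apply: orthonormal_map => // k l _ _; rewrite u_dot ?mem_tnth //.
  by rewrite (inj_eq (elimT (tuple_uniqP u) u_uniq)).
split=> //; rewrite /basis_of eqxx /=; exact: dot_orthonormal_free ui_orth.
Qed.

(** The theorem over an abstract scalar field.  The equations are proved after
    embedding the reals in F, where the Gram matrices live. *)
Theorem sum_cos2_grassmann_angle (n p q : nat) V (w : n.-tuple X) :
    \dim {:X} = n -> \dim V = p -> (q <= n)%N ->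
    orthogonal_basis dot {:X}%VS w ->
  ((p <= q)%N ->
     \sum_(i in increasing_tuples n q)
       cos (grassmann_angle iota dot V (coordinate_subspace w i)) ^+ 2
     = 'C(n - p, n - q)%:R) /\
  ((p > q)%N ->
     \sum_(i in increasing_tuples n q)
       cos (grassmann_angle iota dot (coordinate_subspace w i) V) ^+ 2
     = 'C(p, q)%:R).
Proof.
move=> dimX dimV le_qn w_basis.
have [u u_orth coordE] := orthonormal_coordinates w_basis.
have [a aV] := gram_schmidt V.
have uX : orthonormal_basis dot {:X} u.
  split=> //; rewrite basisEfree (dot_orthonormal_free u_orth) subvf /=.
  by rewrite dimX size_tuple.
have sza : size a = p by rewrite (size_basis_seq aV.1).
pose A := gram dot p n a u; pose B := gram dot n p u a.
have AB1 : A *m B = 1%:M.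
  rewrite -(gram_insertr _ _ _ uX dimX) ?(gram_orthonormal aV.2) //.
  by move=> x _; apply: memvf.
have coordP i : i \in increasing_tuples n q ->
    let ui := [seq tnth u k | k <- i] in
    [/\ orthonormal_basis dot (coordinate_subspace w i) ui,
        \dim (coordinate_subspace w i) = q,
        gram dot p q a ui = colsub (tnth i) A &
        gram dot q p ui a = rowsub (tnth i) B].
  move=> /increasing_uniq i_uniq ui.
  have uiW : orthonormal_basis dot (coordinate_subspace w i) ui.
    by rewrite coordE; apply: coordinate_orthonormal_basis.
  have ui_nth (k : 'I_q) : ui`_k = u`_(tnth i k).
    have k0 : 'I_n := tnth i k.
    rewrite (nth_map k0) ?size_tuple // (tnth_nth 0) /=.
    by rewrite (tnth_nth k0).
  split=> //; first by rewrite -(size_basis_seq uiW.1) size_map size_tuple.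
    by apply/matrixP => k l; rewrite !mxE ui_nth.
  by apply/matrixP => k l; rewrite !mxE ui_nth.
split=> [le_pq|lt_qp]; apply: (fmorph_inj iota); rewrite rmorph_sum rmorph_nat.
  transitivity (\sum_(i in increasing_tuples n q)
      \det (colsub (tnth i) A *m rowsub (tnth i) B)).
    apply: eq_bigr => i /coordP[uiW dimW <- <-].
    exact: cos2_grassmann_angle.
  by rewrite sum_det_increasing // AB1 det1 mulr1.
transitivity (\sum_(i in increasing_tuples n q)
    \det (rowsub (tnth i) B *m colsub (tnth i) A)).
  apply: eq_bigr => i /coordP[uiW dimW <- <-].
  by apply: cos2_grassmann_angle => //; apply: ltnW.
rewrite sum_principal_minors //; last exact: ltnW.
rewrite -card_ltn_sorted_tuples -sumr_const; apply: eq_big => // i.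
move=> /increasing_uniq i_uniq.
have -> : rowsub (tnth i) A *m colsub (tnth i) B =
          mxsub (tnth i) (tnth i) (A *m B).
  by apply/matrixP => k l; rewrite !mxE; apply: eq_bigr => x _; rewrite !mxE.
rewrite AB1 (_ : mxsub _ _ _ = 1%:M) ?det1 //; apply/matrixP => k l.
by rewrite !mxE (inj_eq (elimT (tuple_uniqP i) i_uniq)).
Qed.

End PrincipalAngles.

(** * The real and the complex case *)

(** Over R[i] the matrix is Hermitian, hence diagonalisable with real spectrum, and
    being an eigenvalue does not depend on the field in which it is tested. *)
Lemma real_symmetric_eigenvalue (R : rcfType) n (H : 'M[R]_n.+1) :
  (forall i j, H i j = H j i) -> exists a, eigenvalue H a.
Proof.
move=> H_sym; pose HC : 'M[R[i]]_n.+1 := map_mx (real_complex R) H.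
have HC_herm : HC \is hermitianmx n.+1 false (@Num.conj R[i]).
  apply/is_hermitianmxP; rewrite expr0 scale1r; apply/matrixP => i j.
  rewrite !mxE H_sym; apply/esym/CrealP; apply/complex_realP.
  by exists (H j i).
have /orthomx_spectralP HC_spectral := hermitian_normalmx HC_herm.
(* Any diagonal entry would do; the first one has the first row of the
   diagonalising matrix as eigenvector. *)
have /mxOverP/(_ 0 0)/complex_realP[a a_eq] := hermitian_spectral_diag_real HC_herm.
exists a; suff : eigenvalue HC (spectral_diag HC 0 0).
  by rewrite a_eq -(eigenvalue_map (real_complex R)).
set P := spectralmx HC in HC_spectral.
have P_unit : P \in unitmx := spectral_unit HC.
apply/eigenvalueP; exists (row 0 P).
  rewrite -row_mul [in LHS]HC_spectral !mulmxA mulmxV // mul1mx row_mul.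
  by rewrite row_diag_mx -scalemxAl -rowE.
apply/eqP => P0; have /matrixP/(_ 0 0)/eqP : delta_mx 0 0 = 0 :> 'rV[R[i]]_n.+1.
  by rewrite -[LHS](mulmxK P_unit) -rowE P0 mul0mx.
by rewrite !mxE !eqxx oner_eq0.
Qed.

(* The first conjunct is the real case, the second the complex case. *)
Theorem theorem7p4 (R : realType) :
  (forall (X : vectType R) (dot : {dot X for idfun}) (n p q : nat)
     (V : {vspace X}) (w : n.-tuple X),
     \dim {:X} = n -> \dim V = p -> (q <= n)%N ->
     orthogonal_basis dot {:X}%VS w ->
     ((p <= q)%N ->
        \sum_(i in increasing_tuples n q)
          cos (grassmann_angle (@idfun R) dot V (coordinate_subspace w i)) ^+ 2
        = 'C(n - p, n - q)%:R :> R) /\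
     ((p > q)%N ->
        \sum_(i in increasing_tuples n q)
          cos (grassmann_angle (@idfun R) dot (coordinate_subspace w i) V) ^+ 2
        = 'C(p, q)%:R :> R)) /\
  (forall (X : vectType R[i]) (dot : {dot X for Num.conj}) (n p q : nat)
     (V : {vspace X}) (w : n.-tuple X),
     \dim {:X} = n -> \dim V = p -> (q <= n)%N ->
     orthogonal_basis dot {:X}%VS w ->
     ((p <= q)%N ->
        \sum_(i in increasing_tuples n q)
          cos (grassmann_angle (real_complex R) dot V (coordinate_subspace w i)) ^+ 2
        = 'C(n - p, n - q)%:R :> R) /\
     ((p > q)%N ->
        \sum_(i in increasing_tuples n q)
          cos (grassmann_angle (real_complex R) dot (coordinate_subspace w i) V) ^+ 2
        = 'C(p, q)%:R :> R)).
Proof.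
split=> X dot n p q V w; apply: sum_cos2_grassmann_angle => //.
- by move=> x x_ge0; exists x.
- by move=> m H /= H_sym; apply: real_symmetric_eigenvalue.
- by move=> r; apply/CrealP/complex_realP; exists r.
- move=> x x_ge0; have /complex_realP[r x_r] := ger0_real x_ge0.
  by exists r => //; rewrite -ler0c -x_r.
- by move=> m H _; apply: eigenvalue_closed.
Qed.
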